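(* Fix a feed-forward network with $\ell$ layers and invertible matrices $\Omega_0,\dots,\Omega_\ell$ (with $\Omega_\ell=I$) and $\Phi_1,\dots,\Phi_\ell$ defining the transformed network $f^\dagger$ (all objects as defined in the context). Then there exists an invertible linear function $\zeta$, mapping parameters $\theta^\dagger$ of the transformed network to parameters $\theta=\zeta(\theta^\dagger)$ of the original network, such that: (1) $f^\dagger(x,\theta^\dagger)=f(x,\theta)=f(x,\zeta(\theta^\dagger))$ for all inputs $x$ and all $\theta^\dagger$, so that the transformed network can be viewed as a reparameterization of the original network by $\theta^\dagger$. (2) For every $\theta^\dagger$, with $\theta=\zeta(\theta^\dagger)$, and every scalar $\alpha$: if $\delta=-\alpha \breve F^{-1}\nabla h$ is computed in the original network at $\theta$ and $\delta^\dagger=-\alpha \breve F^{\dagger\,-1}\nabla h^\dagger$ is computed in the transformed network at $\theta^\dagger$, then $\zeta(\theta^\dagger+\delta^\dagger)=\theta+\delta$. Likewise, if $\delta=-\alpha \hat F^{-1}\nabla h$ and $\delta^\dagger=-\alpha \hat F^{\dagger\,-1}\nabla h^\dagger$, then $\zeta(\theta^\dagger+\delta^\dagger)=\theta+\delta$.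
   Context: **Original network.** Layer sizes $d_0,\dots,d_\ell$. For a vector $a$, $\bar a$ denotes $a$ with an extra last coordinate equal to $1$. Given an input $x$, set $a_0=x$ and, for $i=1,\dots,\ell$, $s_i=W_i\bar a_{i-1}$, $a_i=\phi_i(s_i)$, where $W_i\in\mathbb{R}^{d_i\times(d_{i-1}+1)}$ and $\phi_i:\mathbb{R}^{d_i}\to\mathbb{R}^{d_i}$ is an element-wise (differentiable) nonlinearity. The output is $f(x,\theta)=a_\ell$, where $\theta=[\mathrm{vec}(W_1)^\top\cdots\mathrm{vec}(W_\ell)^\top]^\top$ and $\mathrm{vec}$ stacks the columns of a matrix. **Loss and objective.** $L(y,z)=-\log r(y|z)$, where $r(\cdot|z)$ is the density of a predictive distribution $R_{y|z}$. The network defines the conditional model $P_{y|x}(\theta)=R_{y|f(x,\theta)}$. $h(\theta)$ is the expectation of $L(y,f(x,\theta))$ over $(x,y)$ drawn from a training distribution $\hat Q_{x,y}$, whose marginal on inputs is $\hat Q_x$; $\nabla h$ is its gradient in $\theta$. **Fisher approximations.** Let $g_i$ be the gradient of $L(y,f(x,\theta))$ with respect to $s_i$. Below, $\mathrm{E}$ is taken over $x\sim\hat Q_x$ and $y\sim P_{y|x}(\theta)$ (the model's distribution). Put $\bar A_{i,j}=\mathrm{E}[\bar a_i\bar a_j^\top]$ ($0\le i,j\le\ell-1$), $G_{i,j}=\mathrm{E}[g_ig_j^\top]$ ($1\le i,j\le\ell$), and $\tilde F_{i,j}=\bar A_{i-1,j-1}\otimes G_{i,j}$ ($\otimes$ the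 Kronecker product). - $\breve F=\mathrm{diag}(\tilde F_{1,1},\dots,\tilde F_{\ell,\ell})$ (block-diagonal). - $\hat F$ is the matrix agreeing with the block matrix $(\tilde F_{i,j})$ on the tridiagonal blocks and whose inverse is block-tridiagonal. Explicitly, $\hat F^{-1}=\Xi^\top\Lambda\Xi$, where $\Psi_{i,i+1}=\tilde F_{i,i+1}\tilde F_{i+1,i+1}^{-1}$, $\Sigma_{i|i+1}=\tilde F_{i,i}-\Psi_{i,i+1}\tilde F_{i+1,i+1}\Psi_{i,i+1}^\top$ for $1\le i\le \ell-1$, $\Sigma_\ell=\tilde F_{\ell,\ell}$, $\Lambda=\mathrm{diag}(\Sigma_{1|2}^{-1},\dots,\Sigma_{\ell-1|\ell}^{-1},\Sigma_\ell^{-1})$, and $\Xi$ is the block upper-bidiagonal matrix with identity diagonal blocks and $(i,i+1)$ block equal to $-\Psi_{i,i+1}$. **Transformed network.** Let $\bar\phi_i(s)$ be $\phi_i(s)$ with an extra last coordinate $1$. Let $\Omega_i\in\mathbb{R}^{(d_i+1)\times(d_i+1)}$ ($0\le i\le\ell$) and $\Phi_i\in\mathbb{R}^{d_i\times d_i}$ ($1\le i\le\ell$) be arbitrary fixed invertible matrices with $\Omega_\ell=I$. With $\bar a_0^\dagger=\Omega_0\bar a_0$, define for $i=1,\dots,\ell$: $s_i^\dagger=W_i^\dagger\bar a_{i-1}^\dagger$, $\bar a_i^\dagger=\Omega_i\bar\phi_i(\Phi_is_i^\dagger)$, with $W_i^\dagger\in\mathbb{R}^{d_i\times(d_{i-1}+1)}$.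 Let $a_i^\dagger$ be $\bar a_i^\dagger$ without its last coordinate. The output is $f^\dagger(x,\theta^\dagger)=a_\ell^\dagger$, where $\theta^\dagger=[\mathrm{vec}(W_1^\dagger)^\top\cdots\mathrm{vec}(W_\ell^\dagger)^\top]^\top$. A superscript $\dagger$ on any network-dependent quantity denotes the analogous quantity computed from the transformed network: $h^\dagger(\theta^\dagger)$ is the training expectation of $L(y,f^\dagger(x,\theta^\dagger))$ and $\nabla h^\dagger$ its gradient in $\theta^\dagger$; $g_i^\dagger$ is the gradient of $L(y,f^\dagger(x,\theta^\dagger))$ with respect to $s_i^\dagger$; $\bar A^\dagger_{i,j}=\mathrm{E}[\bar a_i^\dagger\bar a_j^{\dagger\top}]$; $G^\dagger_{i,j}=\mathrm{E}[g_i^\dagger g_j^{\dagger\top}]$ (with $y$ from $R_{y|f^\dagger(x,\theta^\dagger)}$); $\breve F^\dagger$, $\hat F^\dagger$ are built from these by the same formulas. **Standing assumptions.** All derivatives and expectations above exist, and the matrices being inverted ($\tilde F_{i,i}$ for $\breve F$; $\tilde F_{i,i}$ and the $\Sigma_{i|i+1}$ for $\hat F$) are invertible in the original network at the parameter under consideration. *)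

(* Defs.v *)
From HB Require Import structures.
From mathcomp Require Export all_boot all_order all_algebra.
From mathcomp Require Export mxtens.
From mathcomp Require Export all_classical all_reals all_analysis.
Export Order.TTheory GRing.Theory Num.Theory.
Export numFieldNormedType.Exports.

Set Implicit Arguments.
Unset Strict Implicit.
Unset Printing Implicit Defensive.

Local Open Scope classical_set_scope.
Local Open Scope ring_scope.

(* R^n with its Borel sigma-algebra. *)
Notation borel_cV R n := (g_sigma_algebraType (@open 'cV[R]_n)).

HB.instance Definition _ d1 d2 (T1 : measurableType d1)
    (T2 : measurableType d2) :=
  isMeasurableFun.Build _ _ (T1 * T2)%type T1 fst measurable_fst.

Section Vectors.
Context {R : realType}.

Definition bar n (a : 'cV[R]_n) : 'cV[R]_(n + 1) := col_mx a 1%:M.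

(* [mxtens_index (j, i) = j * m + i], the index convention shared with the
   Kronecker product [tensmx], so [vec] stacks the columns of [W]. *)
Definition vec m n (W : 'M[R]_(m, n)) : 'cV[R]_(n * m) :=
  \col_k W (mxtens_unindex k).2 (mxtens_unindex k).1.

Definition unvec m n (v : 'cV[R]_(n * m)) : 'M[R]_(m, n) :=
  \matrix_(i, j) v (mxtens_index (j, i)) ord0.

Lemma vecK m n : cancel (@vec m n) (@unvec m n).
Proof. by move=> W; apply/matrixP => i j; rewrite !mxE mxtens_indexK. Qed.

Lemma unvecK m n : cancel (@unvec m n) (@vec m n).
Proof.
move=> v; apply/colP => k; rewrite !mxE -surjective_pairing.
by rewrite mxtens_unindexK.
Qed.

Definition grad n (F : 'cV[R]_n -> R) (z : 'cV[R]_n) : 'cV[R]_n :=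
  \col_k 'D_(delta_mx k ord0) F z.

(* The scalar functions may differ from one coordinate to another. *)
Definition elementwise n (phi : 'cV[R]_n -> 'cV[R]_n) : Prop :=
  exists g : 'I_n -> R -> R, forall s, phi s = \col_k g k (s k ord0).

End Vectors.

(* Layers are indexed from 0: for [i < ell], index [i] below stands for the
   (i+1)-st layer of weights, which goes from size [d i] to size [d i.+1].
   Layer-indexed families are indexed by [nat] so that their dimensions need
   no casts; only indices up to [ell] matter. *)
Section Networks.
Context {R : realType} (ell : nat) (d : nat -> nat).

Definition wsize (i : 'I_ell) : nat := ((d i + 1) * d i.+1)%N.

Definition nparams : nat := (\sum_(i < ell) wsize i)%N.

Definition stack (W : forall i : nat, 'M[R]_(d i.+1, d i + 1)) :
    'cV[R]_nparams :=
  \mxcol_(i < ell) (vec (W i) : 'cV[R]_(wsize i)).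

Definition weight (theta : 'cV[R]_nparams) (i : nat) :
    'M[R]_(d i.+1, d i + 1) :=
  if @idP (i < ell)%N is ReflectT lt_i
  then unvec (submxcol (theta : 'cV[R]_(\sum_(i < ell) wsize i)%N)
                       (Ordinal lt_i))
  else 0.

Lemma stackK W (i : 'I_ell) : weight (stack W) i = W i.
Proof.
rewrite /weight; case: {-}_ / idP => [lt_i|/(_ (ltn_ord i)) []].
by rewrite /stack mxcolK vecK.
Qed.

Lemma weightK theta : stack (weight theta) = theta.
Proof.
rewrite /stack -[RHS]submxcolK; apply: eq_mxcol => -[i lti].
rewrite /weight /=; case: {-}_ / idP => [lt_i|/(_ lti) []].
by rewrite unvecK (bool_irrelevance lt_i lti).
Qed.

(* The original and the transformed networks differ only in how the
   homogeneous activations (those with the extra coordinate) are produced: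
   [init] maps the input to the zeroth one, and [nonlin i] maps [s_(i+1)] to
   the [(i+1)]-st one. *)
Record network := Network {
  init : 'cV[R]_(d 0%N) -> 'cV[R]_(d 0%N + 1);
  nonlin : forall i : nat, 'cV[R]_(d i.+1) -> 'cV[R]_(d i.+1 + 1) }.

Definition original (phi : forall i, 'cV[R]_(d i.+1) -> 'cV[R]_(d i.+1)) :
    network :=
  {| init := fun x => bar x;
     nonlin := fun i s => bar (phi i s) |}.

Definition transformed (phi : forall i, 'cV[R]_(d i.+1) -> 'cV[R]_(d i.+1))
    (Omega : forall i, 'M[R]_(d i + 1)) (Phi : forall i, 'M[R]_(d i.+1)) :
    network :=
  {| init := fun x => Omega 0%N *m bar x;
     nonlin := fun i s => Omega i.+1 *m bar (phi i (Phi i *m s)) |}.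

Section Forward.
Variable (N : network).

Definition linear_layers := forall j, 'cV[R]_(d j + 1) -> 'cV[R]_(d j.+1).

Fixpoint forward (S : linear_layers) (x : 'cV[R]_(d 0%N)) (i : nat) :
    'cV[R]_(d i + 1) :=
  if i is j.+1 then nonlin N (S j (forward S x j)) else init N x.

Definition layers (theta : 'cV[R]_nparams) : linear_layers :=
  fun j a => weight theta j *m a.
Arguments layers theta : clear implicits.

Definition abar theta x i : 'cV[R]_(d i + 1) := forward (layers theta) x i.

Definition preact theta x i : 'cV[R]_(d i.+1) :=
  weight theta i *m abar theta x i.

Definition output theta x : 'cV[R]_(d ell) := usubmx (abar theta x ell).

(* The output as a function of the value [s] of the preactivation of layer
   [i], everything downstream being recomputed from it. *)
Definition output_from theta x i (s : 'cV[R]_(d i.+1)) : 'cV[R]_(d ell) :=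
  usubmx (forward
    (eqtype.dfwith (layers theta) (i := i) (fun _ : 'cV[R]_(d i + 1) => s)) x ell).

Lemma output_from_preact theta x i :
  output_from theta x (preact theta x i) = output theta x.
Proof.
rewrite /output_from /output /abar; congr usubmx.
set S' := eqtype.dfwith _ _; suff fwdE j : forward S' x j = forward (layers theta) x j.
  exact: fwdE.
elim: j => //= j ->; congr nonlin; rewrite /S'.
by case: (eqVneq i j) => [<-|ij]; rewrite (dfwith_in, eqtype.dfwith_out).
Qed.

End Forward.
End Networks.

Section Fisher.
Context {R : realType} {dY : measure_display} {Y : measurableType dY}.
Context (mu : {sigma_finite_measure set Y -> \bar R}).

(* [r z] is the density of the predictive distribution [R_(y|z)] with respect
   to the reference measure [mu]. *)
Definition is_predictive_density n (r : 'cV[R]_n -> Y -> R) : Prop :=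
  forall z, [/\ measurable_fun setT (r z), (forall y, 0 <= r z y)
    & (\int[mu]_y (r z y)%:E = 1)%E].

Definition loss n (r : 'cV[R]_n -> Y -> R) (y : Y) (z : 'cV[R]_n) : R :=
  - ln (r z y).

Context (ell : nat) (d : nat -> nat) (r : 'cV[R]_(d ell) -> Y -> R).
Context (Qhat : probability (borel_cV R (d 0%N) * Y)%type R).
Context (N : network (R := R) d).
Local Notation theta_t := 'cV[R]_(nparams ell d).
Implicit Type theta : theta_t.

Definition sample_loss theta (p : borel_cV R (d 0%N) * Y) : R :=
  loss r p.2 (output N theta p.1).

Definition objective theta : R := \int[Qhat]_p sample_loss theta p.

Definition Qhat_x : probability (borel_cV R (d 0%N)) R := distribution Qhat fst.

(* Under [x ~ Qhat_x] and [y ~ R_(y|f(x,theta))], the pair [(x, y)] has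
   density [r (f(x,theta)) y] with respect to the product of [Qhat_x] and
   [mu]. *)
Definition weighted theta (F : 'cV[R]_(d 0%N) -> Y -> R)
    (p : borel_cV R (d 0%N) * Y) : R :=
  F p.1 p.2 * r (output N theta p.1) p.2.

Definition model_integrable theta (F : 'cV[R]_(d 0%N) -> Y -> R) : Prop :=
  (Qhat_x \x mu)%E.-integrable setT (EFin \o weighted theta F).

Definition model_expectation theta (F : 'cV[R]_(d 0%N) -> Y -> R) : R :=
  \int[(Qhat_x \x mu)%E]_p weighted theta F p.

Definition model_integrable_mx theta m n
    (F : 'cV[R]_(d 0%N) -> Y -> 'M[R]_(m, n)) : Prop :=
  forall a b, model_integrable theta (fun x y => F x y a b).

Definition model_expectation_mx theta m n
    (F : 'cV[R]_(d 0%N) -> Y -> 'M[R]_(m, n)) : 'M[R]_(m, n) :=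
  \matrix_(a, b) model_expectation theta (fun x y => F x y a b).

Definition loss_from theta x y i (s : 'cV[R]_(d i.+1)) : R :=
  loss r y (output_from N theta x s).

Definition sgrad theta x y i : 'cV[R]_(d i.+1) :=
  grad (loss_from theta x y (i := i)) (preact N theta x i).

Definition aaT theta i j (x : 'cV[R]_(d 0%N)) (y : Y) :=
  abar N theta x i *m (abar N theta x j)^T.

Definition ggT theta i j (x : 'cV[R]_(d 0%N)) (y : Y) :=
  sgrad theta x y i *m (sgrad theta x y j)^T.

Definition Amx theta i j : 'M[R]_(d i + 1, d j + 1) :=
  model_expectation_mx theta (aaT theta i j).

Definition Gmx theta i j : 'M[R]_(d i.+1, d j.+1) :=
  model_expectation_mx theta (ggT theta i j).

Definition Ftilde theta (i j : 'I_ell) :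
    'M[R]_(wsize d i, wsize d j) :=
  tensmx (Amx theta i j) (Gmx theta i j).

Definition Fbreve theta : 'M[R]_(nparams ell d) :=
  \mxdiag_(i < ell) Ftilde theta i i.

Definition Psi theta (i j : 'I_ell) : 'M[R]_(wsize d i, wsize d j) :=
  Ftilde theta i j *m invmx (Ftilde theta j j).

(* [Sigma_(i|i+1)], or [Sigma_ell] for the last layer. *)
Definition Sigma theta (i : 'I_ell) : 'M[R]_(wsize d i) :=
  if (insub i.+1 : option 'I_ell) is Some j then
    Ftilde theta i i
      - Psi theta i j *m Ftilde theta j j *m (Psi theta i j)^T
  else Ftilde theta i i.

Definition Lambda theta : 'M[R]_(nparams ell d) :=
  \mxdiag_(i < ell) invmx (Sigma theta i).

Definition Xi theta : 'M[R]_(nparams ell d) :=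
  1%:M - \mxblock_(i < ell, j < ell)
           (if j == i.+1 :> nat then Psi theta i j else 0).

Definition Fhat theta : 'M[R]_(nparams ell d) :=
  invmx ((Xi theta)^T *m Lambda theta *m Xi theta).

Definition update (F : theta_t -> 'M[R]_(nparams ell d)) (alpha : R) theta :
    theta_t :=
  - alpha *: (invmx (F theta) *m grad objective theta).

(* Existence at [theta] of all the expectations and derivatives above.
   Since [ln 0 = 0], [loss] is 0 rather than infinite where [r] vanishes; not
   requiring [r] to be positive only admits more models. *)
Definition regular theta : Prop :=
  [/\ \forall theta' \near theta,
        Qhat.-integrable setT (EFin \o sample_loss theta'),
      differentiable objective theta,
      forall (i : 'I_ell) x y,
        differentiable (loss_from theta x y (i := i)) (preact N theta x i),
      forall i j : 'I_ell, model_integrable_mx theta (aaT theta i j)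
    & forall i j : 'I_ell, model_integrable_mx theta (ggT theta i j)].

End Fisher.

(* Main.v *)
(* Put W_i = Phi_i W_i^dagger Omega_(i-1). By induction over the layers,
   abar_i^dagger = Omega_i abar_i and s_i = Phi_i s_i^dagger, so both networks
   compute the same function. In vectorized form this is theta = J theta^dagger
   with J block-diagonal, its blocks being J_i = Omega_(i-1)^T (x) Phi_i. The
   chain rule gives g_i^dagger = Phi_i^T g_i and grad h^dagger = J^T grad h,
   hence Ftilde_(i,j)^dagger = J_i^T Ftilde_(i,j) J_j. Since J is
   block-diagonal, this congruence passes to Fbreve and, through Psi, Sigma, Xi and Lambda, to Fhat; any curvature matrix
   with F^dagger = J^T F J yields delta = J delta^dagger. *)
Require Import Defs.

Set Implicit Arguments.
Unset Strict Implicit.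
Unset Printing Implicit Defensive.

Local Open Scope classical_set_scope.
Local Open Scope ring_scope.

(** * Inverses of Kronecker products and of block-diagonal matrices *)

Section Matrices.
Context {R : fieldType}.

Lemma tens1mx m n : (1%:M : 'M[R]_m) *t (1%:M : 'M[R]_n) = 1%:M.
Proof.
apply/matrixP => i j; rewrite !mxE -natrM mulnb; congr (_ *+ nat_of_bool _).
by rewrite -(inj_eq (can_inj (@mxtens_unindexK m n))) [RHS]xpair_eqE.
Qed.

Lemma tensmx_unitmx m n (A : 'M[R]_m) (B : 'M[R]_n) :
  A \in unitmx -> B \in unitmx -> A *t B \in unitmx.
Proof.
move=> uA uB; suff /mulmx1_unit[] : A *t B *m (invmx A *t invmx B) = 1%:M by [].
by rewrite tensmx_mul !mulmxV // tens1mx.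
Qed.

Lemma invmxM n (A B : 'M[R]_n) : A \in unitmx -> B \in unitmx ->
  invmx (A *m B) = invmx B *m invmx A.
Proof.
move=> uA uB; have uAB : A *m B \in unitmx by rewrite unitmx_mul uA.
apply: (can_inj (mulKmx uAB)).
by rewrite mulmxV // -mulmxA mulKVmx // mulmxV.
Qed.

Lemma mul_mxdiag p (p_ : 'I_p -> nat) (D E : forall i, 'M[R]_(p_ i)) :
  \mxdiag_i D i *m \mxdiag_i E i = \mxdiag_i (D i *m E i).
Proof.
rewrite [\mxdiag_i E i]/mxdiag mul_mxdiag_mxblock; apply: eq_mxblock => i j.
(* The blocks of [\mxdiag] are cast by [conform_mx], and the cast is trivial on the diagonal. *)
by case: eqVneq => [<-|_]; rewrite ?conform_mx_id ?mulmx0.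
Qed.

Lemma mxdiag_unit p (p_ : 'I_p -> nat) (D : forall i, 'M[R]_(p_ i)) :
  (forall i, D i \in unitmx) -> \mxdiag_i D i \in unitmx.
Proof.
move=> uD; suff /mulmx1_unit[] :
  \mxdiag_i D i *m \mxdiag_i invmx (D i) = 1%:M by [].
rewrite mul_mxdiag -[RHS](mxdiagZ (p_ := p_)); apply: eq_mxdiag => i.
by rewrite mulmxV.
Qed.

Lemma invmx_mxdiag p (p_ : 'I_p -> nat) (D : forall i, 'M[R]_(p_ i)) :
  (forall i, D i \in unitmx) ->
  invmx (\mxdiag_i D i) = \mxdiag_i invmx (D i).
Proof.
move=> uD; apply: (can_inj (mulKmx (mxdiag_unit uD))).
rewrite mulmxV ?mxdiag_unit // mul_mxdiag -[LHS](mxdiagZ (p_ := p_)).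
by apply: eq_mxdiag => i; rewrite mulmxV.
Qed.

(** The shape of the change in [Fhat]: the inner factors of [J] and its inverse cancel. Only [J]
    need be invertible, as [invmx] is an involution on all matrices. *)
Lemma invmx_factored_transform n (J X L : 'M[R]_n) : J \in unitmx ->
  let X' := J^T *m X *m (invmx J)^T in
  let L' := invmx J *m L *m (invmx J)^T in
  invmx (invmx (X'^T *m L' *m X'))
  = invmx J *m invmx (invmx (X^T *m L *m X)) *m (invmx J)^T.
Proof.
move=> uJ /=; rewrite !invmxK !trmx_mul !trmxK -!mulmxA mulKVmx //.
by rewrite trmx_inv mulKmx ?unitmx_tr.
Qed.

End Matrices.

(** * Vectorization and the chain rule for linear maps *)

Section Analysis.
Context {R : realType}.

Lemma vecM m n p q (A : 'M[R]_(m, n)) (X : 'M[R]_(n, p)) (B : 'M[R]_(p, q)) :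
  vec (A *m X *m B) = (B^T *t A) *m vec X.
Proof.
apply/colP => k; rewrite !mxE; set i := (mxtens_unindex k).2.
set j := (mxtens_unindex k).1.
under eq_bigr do rewrite mxE big_distrl /=.
rewrite pair_bigA [RHS](reindex (@mxtens_index p n)) /=; last first.
  by exists (@mxtens_unindex p n) => ? _;
    rewrite (mxtens_indexK, mxtens_unindexK).
apply: eq_bigr => -[l a] _ /=; rewrite !mxE mxtens_indexK /=.
by rewrite mulrC mulrA.
Qed.

Lemma grad_comp_linear m n (F : 'cV[R]_m -> R) (A : 'M[R]_(m, n)) z :
  differentiable F (A *m z) ->
  grad (fun w => F (A *m w)) z = A^T *m grad F (A *m z).
Proof.
move=> dF; apply/colP => k; rewrite !mxE.
(* The two difference quotients coincide, so this needs no differentiability. *)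
have -> : 'D_(delta_mx k ord0) (fun w => F (A *m w)) z
  = 'D_(A *m delta_mx k ord0) F (A *m z).
  by rewrite /derive; under eq_fun do rewrite /= mulmxDr -scalemxAr.
rewrite deriveE //.
set v := A *m delta_mx k ord0.
(* The differential is linear in the direction; expanding column [k] of [A] on the basis gives row
   [k] of [A^T] against the gradient. *)
rewrite [v in LHS]matrix_sum_delta linear_sum.
apply: eq_bigr => j _; rewrite big_ord1 linearZ /= /v !mxE deriveE //.
rewrite (bigD1 k) //= !mxE !eqxx mulr1 big1 ?addr0 // => l /negPf lk.
by rewrite mxE lk mulr0.
Qed.

End Analysis.

(** * Finite sums under the integral *)

Section Integrals.
Context {d : measure_display} {T : measurableType d} {R : realType}.
Context (mu : {measure set T -> \bar R}) (D : set T) (mD : measurable D).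

Lemma integrable_fin_sum (I : Type) (s : seq I) (h : I -> T -> R) :
  (forall i, mu.-integrable D (EFin \o h i)) ->
  mu.-integrable D (EFin \o (fun x => \sum_(i <- s) h i x)).
Proof.
move=> ih.
have -> : EFin \o (fun x => \sum_(i <- s) h i x)
   = (fun x => \sum_(i <- s) (EFin \o h i) x)%E.
  by apply/funext => x /=; rewrite sumEFin.
exact: integrable_sum.
Qed.

Lemma Rintegral_sum (I : Type) (s : seq I) (h : I -> T -> R) :
  (forall i, mu.-integrable D (EFin \o h i)) ->
  \int[mu]_(x in D) (\sum_(i <- s) h i x)
  = \sum_(i <- s) \int[mu]_(x in D) h i x.
Proof.
move=> ih; elim: s => [|i s IH].
  under eq_Rintegral do rewrite big_nil.
  by rewrite Rintegral_cst // mul0r big_nil.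
under eq_Rintegral do rewrite big_cons.
by rewrite RintegralD //; [rewrite IH big_cons|exact: integrable_fin_sum].
Qed.

End Integrals.

(** * Linearity of matrix-valued expectations *)

Section Expectations.
Context {R : realType} {dY : measure_display} {Y : measurableType dY}.
Context (mu : {sigma_finite_measure set Y -> \bar R}).
Context (ell : nat) (d : nat -> nat) (r : 'cV[R]_(d ell) -> Y -> R).
Context (Qhat : probability (borel_cV R (d 0%N) * Y)%type R).
Context (N : network (R := R) d) (theta : 'cV[R]_(nparams ell d)).

Lemma model_expectation_mxM m n p q (A : 'M[R]_(p, m)) (B : 'M[R]_(n, q))
    (F : 'cV[R]_(d 0%N) -> Y -> 'M[R]_(m, n)) :
  model_integrable_mx mu r Qhat N theta F ->
  model_expectation_mx mu r Qhat N theta (fun x y => A *m F x y *m B)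
  = A *m model_expectation_mx mu r Qhat N theta F *m B.
Proof.
move=> intF; apply/matrixP => a b; rewrite !mxE.
(* Each entry of the product is a finite combination of entries of [F], indexed by pairs so that the
   sum leaves the integral in one step. *)
have -> : model_expectation mu r Qhat N theta
    (fun x y => (A *m F x y *m B) a b)
  = \int[(Qhat_x Qhat \x mu)%E]_p \sum_k
      (A a k.2 * B k.1 b) * weighted r N theta (fun x y => F x y k.2 k.1) p.
  apply: eq_Rintegral => z _; rewrite /weighted mxE big_distrl /=.
  rewrite -(pair_bigA _ (fun j i => A a i * B j b *
     (F z.1 z.2 i j * r (output N theta z.1) z.2))) /=.
  apply: eq_bigr => j _; rewrite mxE !big_distrl /=.
  by apply: eq_bigr => i _; rewrite mulrACA mulrA.
rewrite Rintegral_sum //; last first.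
  move=> [j i] /=; rewrite (_ : _ \o _ = fun p => ((A a i * B j b)%:E *
     (EFin \o weighted r N theta (fun x y => F x y i j)) p)%E).
    by apply: integrableZl => //; exact: intF.
  by apply/funext => z /=; rewrite EFinM.
rewrite -(pair_bigA _ (fun j i => \int[(Qhat_x Qhat \x mu)%E]_p
  (A a i * B j b * weighted r N theta (fun x y => F x y i j) p))) /=.
apply: eq_bigr => j _; rewrite mxE big_distrl /=.
apply: eq_bigr => i _; rewrite RintegralZl //; last exact: intF.
by rewrite mxE mulrAC.
Qed.

End Expectations.

(** * The change of parameters and its effect on the network *)

Section Reparameterization.
Context {R : realType} (ell : nat) (d : nat -> nat).
Context (phi : forall i : nat, 'cV[R]_(d i.+1) -> 'cV[R]_(d i.+1)).
Context (Omega : forall i : nat, 'M[R]_(d i + 1)).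
Context (Phi : forall i : nat, 'M[R]_(d i.+1)).
Local Notation net := (original phi).
Local Notation net' := (transformed phi Omega Phi).

(** With layers counted from 0, [Omega i] acts on the input of layer [i] and [Phi i] on its
    preactivation. *)
Definition layer_jacobian (i : 'I_ell) : 'M[R]_(wsize d i) :=
  (Omega i)^T *t Phi i.

Definition jacobian : 'M[R]_(nparams ell d) :=
  \mxdiag_(i < ell) layer_jacobian i.

Lemma tr_jacobian : jacobian^T = \mxdiag_(i < ell) (layer_jacobian i)^T.
Proof. exact: tr_mxdiag. Qed.

Lemma weight_jacobian (theta' : 'cV[R]_(nparams ell d)) i : (i < ell)%N ->
  weight (jacobian *m theta') i = Phi i *m weight theta' i *m Omega i.
Proof.
move=> lti; rewrite -{1}(weightK theta') /stack mul_mxdiag_mxcol.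
rewrite (_ : mxcol _ =
  stack ell (fun j => Phi j *m weight theta' j *m Omega j)).
  exact: (stackK _ (Ordinal lti)).
by apply: eq_mxcol => j; rewrite vecM.
Qed.

(** Arbitrary layer maps are allowed so that the same induction serves the plain forward pass and
    the one restarted from a prescribed preactivation. *)
Lemma forward_transformed (S S' : linear_layers d) x k :
  (forall j a, (j < k)%N -> Phi j *m S' j (Omega j *m a) = S j a) ->
  forward net' S' x k = Omega k *m forward net S x k.
Proof.
elim: k => //= k IH SS'; rewrite IH => [|j a /ltnW]; last exact: SS'.
by rewrite SS'.
Qed.

Section Transformed.
Variable theta' : 'cV[R]_(nparams ell d).
Local Notation theta := (jacobian *m theta').

Lemma abar_transformed x i : (i <= ell)%N ->
  abar net' theta' x i = Omega i *m abar net theta x i.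
Proof.
move=> lei; apply: forward_transformed => j a ltj.
by rewrite /layers weight_jacobian ?(leq_trans ltj) // !mulmxA.
Qed.

Lemma preact_transformed x i : (i < ell)%N ->
  preact net theta x i = Phi i *m preact net' theta' x i.
Proof.
by move=> lti; rewrite /preact abar_transformed 1?ltnW // weight_jacobian //
  !mulmxA.
Qed.

Hypothesis Omega_last : Omega ell = 1%:M.

Lemma output_transformed x : output net' theta' x = output net theta x.
Proof. by rewrite /output abar_transformed // Omega_last mul1mx. Qed.

Lemma output_from_transformed x i (s : 'cV[R]_(d i.+1)) :
  output_from net' theta' x s = output_from net theta x (Phi i *m s).
Proof.
rewrite /output_from; congr usubmx.
(* At layer [i] the two maps are the constants [s] and [Phi i *m s]; the other layers are related by
   their weights. *)
rewrite -[RHS]mul1mx -Omega_last; apply: forward_transformed => j a ltj.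
case: (eqVneq i j) => ij.
  by case: j / ij a ltj => a _; rewrite !dfwith_in.
by rewrite !dfwith_out // /layers weight_jacobian // !mulmxA.
Qed.

Context {dY : measure_display} {Y : measurableType dY}.
Context (mu : {sigma_finite_measure set Y -> \bar R}).
Context (r : 'cV[R]_(d ell) -> Y -> R).
Context (Qhat : probability (borel_cV R (d 0%N) * Y)%type R).
Hypothesis reg : regular mu r Qhat net theta.

Lemma objective_transformed : objective r Qhat net' theta'
  = objective r Qhat net theta.
Proof.
by apply: eq_Rintegral => z _; rewrite /sample_loss output_transformed.
Qed.

(** Equal outputs give the same predictive density, so both networks average over the same model
    distribution. *)
Lemma model_expectation_transformed m n
    (F : 'cV[R]_(d 0%N) -> Y -> 'M[R]_(m, n)) :
  model_expectation_mx mu r Qhat net' theta' F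
  = model_expectation_mx mu r Qhat net theta F.
Proof.
apply/matrixP => a b; rewrite !mxE; apply: eq_Rintegral => z _.
by rewrite /weighted output_transformed.
Qed.

Lemma sgrad_transformed x y (i : 'I_ell) :
  sgrad r net' theta' x y i = (Phi i)^T *m sgrad r net theta x y i.
Proof.
rewrite /sgrad preact_transformed //.
have -> : loss_from r net' theta' x y (i := i)
    = (fun s => loss_from r net theta x y (i := i) (Phi i *m s)).
  by apply/funext => s; rewrite /loss_from output_from_transformed.
apply: grad_comp_linear.
by rewrite -preact_transformed //; case: reg.
Qed.

Lemma Amx_transformed (i j : 'I_ell) : Amx mu r Qhat net' theta' i j
  = Omega i *m Amx mu r Qhat net theta i j *m (Omega j)^T.
Proof.
rewrite /Amx model_expectation_transformed -model_expectation_mxM.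
  congr model_expectation_mx; apply/funext => x; apply/funext => y.
  by rewrite /aaT !abar_transformed 1?ltnW // trmx_mul !mulmxA.
by case: reg.
Qed.

Lemma Gmx_transformed (i j : 'I_ell) : Gmx mu r Qhat net' theta' i j
  = (Phi i)^T *m Gmx mu r Qhat net theta i j *m Phi j.
Proof.
rewrite /Gmx model_expectation_transformed -model_expectation_mxM.
  congr model_expectation_mx; apply/funext => x; apply/funext => y.
  by rewrite /ggT !sgrad_transformed trmx_mul trmxK !mulmxA.
by case: reg.
Qed.

(** The mixed-product rule regroups the factors around [Amx] and [Gmx] into Kronecker products. *)
Lemma Ftilde_transformed (i j : 'I_ell) : Ftilde mu r Qhat net' theta' i j
  = (layer_jacobian i)^T *m Ftilde mu r Qhat net theta i j
      *m layer_jacobian j.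
Proof.
rewrite /Ftilde Amx_transformed Gmx_transformed /layer_jacobian trmx_tens.
by rewrite trmxK !tensmx_mul.
Qed.

End Transformed.

(** * The gradient of the objective *)

Section Gradient.
Context (theta' : 'cV[R]_(nparams ell d)) (Omega_last : Omega ell = 1%:M).
Context {dY : measure_display} {Y : measurableType dY}.
Context (r : 'cV[R]_(d ell) -> Y -> R).
Context (Qhat : probability (borel_cV R (d 0%N) * Y)%type R).

Lemma grad_objective_transformed :
  differentiable (objective r Qhat net) (jacobian *m theta') ->
  grad (objective r Qhat net') theta'
  = jacobian^T *m grad (objective r Qhat net) (jacobian *m theta').
Proof.
(* Differentiating requires equality of the objectives as functions, not only at [theta']. *)
move=> dF; have -> : objective r Qhat net'
    = (fun t => objective r Qhat net (jacobian *m t)).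
  by apply/funext => t; exact: objective_transformed.
exact: grad_comp_linear.
Qed.

End Gradient.

Hypothesis Omega_last : Omega ell = 1%:M.
Hypothesis Omega_unit : forall i, (i <= ell)%N -> Omega i \in unitmx.
Hypothesis Phi_unit : forall i, (i < ell)%N -> Phi i \in unitmx.

Lemma layer_jacobian_unit i : layer_jacobian i \in unitmx.
Proof.
by rewrite tensmx_unitmx ?unitmx_tr ?Omega_unit ?Phi_unit // ltnW.
Qed.

Lemma jacobian_unit : jacobian \in unitmx.
Proof. by apply: mxdiag_unit => i; exact: layer_jacobian_unit. Qed.

Lemma invmx_jacobian :
  invmx jacobian = \mxdiag_(i < ell) invmx (layer_jacobian i).
Proof. exact: invmx_mxdiag layer_jacobian_unit. Qed.

(** * Curvature matrices and the resulting updates *)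

Section Updates.
Context {dY : measure_display} {Y : measurableType dY}.
Context (mu : {sigma_finite_measure set Y -> \bar R}).
Context (r : 'cV[R]_(d ell) -> Y -> R).
Context (Qhat : probability (borel_cV R (d 0%N) * Y)%type R).
Context (theta' : 'cV[R]_(nparams ell d)).
Local Notation theta := (jacobian *m theta').
Hypothesis reg : regular mu r Qhat net theta.
Hypothesis Ftilde_unit :
  forall i : 'I_ell, Ftilde mu r Qhat net theta i i \in unitmx.

(** The outer [jacobian] cancels its inverse, and the transposed inverse cancels the [jacobian^T] of
    the gradient. Assuming the relation on inverses covers both approximations. *)
Lemma update_transformed alpha
    (F F' : 'cV[R]_(nparams ell d) -> 'M[R]_(nparams ell d)) :
  invmx (F' theta') = invmx jacobian *m invmx (F theta) *m (invmx jacobian)^T ->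
  jacobian *m (theta' + update r Qhat net' F' alpha theta')
  = theta + update r Qhat net F alpha theta.
Proof.
have uJ := jacobian_unit => FE; rewrite mulmxDr /update -scalemxAr FE.
rewrite grad_objective_transformed //; last by case: reg.
by rewrite -!mulmxA mulKVmx // trmx_inv mulKmx // unitmx_tr.
Qed.

Lemma Fbreve_transformed : Fbreve mu r Qhat net' theta'
  = jacobian^T *m Fbreve mu r Qhat net theta *m jacobian.
Proof.
rewrite /Fbreve /jacobian tr_mxdiag !mul_mxdiag; apply: eq_mxdiag => i.
exact: Ftilde_transformed.
Qed.

Lemma invmx_Fbreve_transformed : invmx (Fbreve mu r Qhat net' theta')
  = invmx jacobian *m invmx (Fbreve mu r Qhat net theta)
      *m (invmx jacobian)^T.
Proof.
have uF : Fbreve mu r Qhat net theta \in unitmx by apply: mxdiag_unit.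
have uJ := jacobian_unit.
rewrite Fbreve_transformed !invmxM ?unitmx_mul ?unitmx_tr ?uF ?uJ //.
by rewrite mulmxA trmx_inv.
Qed.

(** The right factor of [Ftilde i j] cancels against the inverse of [Ftilde j j], leaving a
    transposed inverse on the right. *)
Lemma Psi_transformed (i j : 'I_ell) : Psi mu r Qhat net' theta' i j
  = (layer_jacobian i)^T *m Psi mu r Qhat net theta i j
      *m (invmx (layer_jacobian j))^T.
Proof.
have uJ := layer_jacobian_unit j.
rewrite /Psi !Ftilde_transformed // !invmxM ?unitmx_mul ?unitmx_tr ?uJ //=.
by rewrite -!mulmxA mulKVmx // trmx_inv.
Qed.

Lemma Sigma_transformed (i : 'I_ell) : Sigma mu r Qhat net' theta' i
  = (layer_jacobian i)^T *m Sigma mu r Qhat net theta i *m layer_jacobian i.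
Proof.
(* [insub] fails exactly at the last layer, where [Sigma] is [Ftilde i i]. *)
rewrite /Sigma; case: insub => [j|]; last exact: Ftilde_transformed.
have uJ := layer_jacobian_unit j.
rewrite mulmxBr mulmxBl Ftilde_transformed // Psi_transformed.
rewrite Ftilde_transformed //; congr (_ - _).
rewrite !trmx_mul !trmxK trmx_inv -!mulmxA; congr (_ *m (_ *m _)).
by rewrite mulKmx ?unitmx_tr // mulKVmx.
Qed.

Lemma Xi_transformed : Xi mu r Qhat net' theta'
  = jacobian^T *m Xi mu r Qhat net theta *m (invmx jacobian)^T.
Proof.
have uJ := jacobian_unit.
(* The identity part is preserved because the outer factors are inverse to each other; only the
   [Psi] blocks remain. *)
rewrite /Xi mulmxBr mulmxBl mulmx1 -trmx_mul mulVmx // trmx1; congr (_ - _).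
rewrite tr_jacobian invmx_jacobian tr_mxdiag.
rewrite mul_mxdiag_mxblock mul_mxblock_mxdiag; apply: eq_mxblock => i j.
case: (j == i.+1 :> nat); last by rewrite mulmx0 mul0mx.
by rewrite Psi_transformed.
Qed.

Hypothesis Sigma_unit :
  forall i : 'I_ell, Sigma mu r Qhat net theta i \in unitmx.

Lemma Lambda_transformed : Lambda mu r Qhat net' theta'
  = invmx jacobian *m Lambda mu r Qhat net theta *m (invmx jacobian)^T.
Proof.
rewrite invmx_jacobian tr_mxdiag !mul_mxdiag; apply: eq_mxdiag => i.
have uJ := layer_jacobian_unit i.
rewrite Sigma_transformed !invmxM ?unitmx_mul ?unitmx_tr ?uJ ?Sigma_unit //.
by rewrite mulmxA trmx_inv.
Qed.

Lemma invmx_Fhat_transformed : invmx (Fhat mu r Qhat net' theta')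
  = invmx jacobian *m invmx (Fhat mu r Qhat net theta) *m (invmx jacobian)^T.
Proof.
rewrite /Fhat Lambda_transformed Xi_transformed.
exact: invmx_factored_transform jacobian_unit.
Qed.

End Updates.
End Reparameterization.

Theorem theorem1 (R : realType) (ell : nat) (d : nat -> nat)
    (phi : forall i : nat, 'cV[R]_(d i.+1) -> 'cV[R]_(d i.+1))
    (Omega : forall i : nat, 'M[R]_(d i + 1))
    (Phi : forall i : nat, 'M[R]_(d i.+1))
    (phi_elementwise : forall i, (i < ell)%N -> elementwise (phi i))
    (phi_differentiable : forall i, (i < ell)%N ->
       forall s, differentiable (phi i) s)
    (Omega_unit : forall i, (i <= ell)%N -> Omega i \in unitmx)
    (Omega_last : Omega ell = 1%:M)
    (Phi_unit : forall i, (i < ell)%N -> Phi i \in unitmx) :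
  let net := original phi in
  let net' := transformed phi Omega Phi in
  exists zeta : {linear 'cV[R]_(nparams ell d) -> 'cV[R]_(nparams ell d)},
    [/\ bijective zeta,
        forall (theta' : 'cV[R]_(nparams ell d)) (x : 'cV[R]_(d 0%N)),
          output net' theta' x = output net (zeta theta') x
      & forall (dY : measure_display) (Y : measurableType dY)
          (mu : {sigma_finite_measure set Y -> \bar R})
          (r : 'cV[R]_(d ell) -> Y -> R)
          (Qhat : probability (borel_cV R (d 0%N) * Y)%type R),
        is_predictive_density mu r ->
        forall theta' : 'cV[R]_(nparams ell d),
        let theta := zeta theta' in
        regular mu r Qhat net theta ->
        (forall i : 'I_ell, Ftilde mu r Qhat net theta i i \in unitmx) ->
        forall alpha : R,
          zeta (theta'
                + update r Qhat net' (Fbreve mu r Qhat net') alpha theta')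
          = theta + update r Qhat net (Fbreve mu r Qhat net) alpha theta
          /\
          ((forall i : 'I_ell, Sigma mu r Qhat net theta i \in unitmx) ->
           zeta (theta'
                 + update r Qhat net' (Fhat mu r Qhat net') alpha theta')
           = theta + update r Qhat net (Fhat mu r Qhat net) alpha theta)].
Proof.
move=> net net'; have uJ := jacobian_unit Omega_unit Phi_unit.
(* Left multiplication by the Jacobian carries the required linear structure canonically. *)
exists (mulmx (jacobian ell Omega Phi)); split.
- by exists (mulmx (invmx (jacobian ell Omega Phi))) => v;
    rewrite /= (mulKmx uJ, mulKVmx uJ).
- by move=> theta' x; exact: output_transformed.
move=> dY Y mu r Qhat _ theta' theta reg uF alpha; split=> [|uS];
  apply: (update_transformed _ _ _ reg) => //.
- exact: invmx_Fbreve_transformed.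
- exact: invmx_Fhat_transformed.
Qed.
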